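(* Let $X$ be a $d$-dimensional crystal lattice and let $\nu$ be a probability measure on $[0,\infty)$ with $\mathbb{E}\big[\min\{t_1,\dots,t_{l_X}\}^d\big]<\infty$, where $t_1,\dots,t_{l_X}$ are i.i.d. with law $\nu$ and $l_X$ is the edge connectivity of $X$. For a nondegenerate periodic realization $(\Phi,\rho)$ of $X$ let $\mathcal{B}_\Phi\subset\mathbb{R}^d$ be the limit shape of the first passage percolation model with time distribution $\nu$. Then: 1. The limit shape depends only on $X$, $\nu$ and the period: for two nondegenerate periodic realizations $(\Phi,\rho)$, $(\Phi',\rho')$ of $X$ with $\rho=\rho'$, one has $\mathcal{B}_\Phi=\mathcal{B}_{\Phi'}$. 2. $\mathcal{B}_\Phi=\mathcal{B}_{\Phi+\mathbf{b}}$ for any $\mathbf{b}\in\mathbb{R}^d$, where $\Phi+\mathbf{b}$ is the periodic realization $x\mapsto\Phi(x)+\mathbf{b}$. 3. $\mathcal{B}_{A\circ\Phi}=A\,\mathcal{B}_\Phi$ for any $A\in GL_d(\mathbb{R})$, where $A\circ\Phi$ is the periodic realization with period homomorphism $A\circ\rho$.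
   Context: Graphs. A graph $X=(V,E)$ consists of sets $V,E$, a map $E\to V\times V$, $e\mapsto(o(e),t(e))$, and an involution $e\mapsto\bar e$ of $E$ with $\bar e\neq e$, $o(\bar e)=t(e)$, $t(\bar e)=o(e)$ (loops and parallel edges are allowed). A group $G$ acts freely on $X$ if it acts by graph automorphisms, the action on $V$ is free, and $ge\neq\bar e$ for all $g\in G$, $e\in E$; the quotient graph $X/G$ has vertex set $V/G$ and edge set $E/G$. A $d$-dimensional crystal lattice is a connected graph $X$ with a free action of a free abelian group $L$ of rank $d$ (the abstract period lattice) such that $X/L$ is finite. For percolation purposes $e$ and $\bar e$ are identified. The edge connectivity $l_X$ is the minimum number of (undirected) edges whose removal disconnects $X$. Realizations. A periodic realization is a map $\Phi:V\to\mathbb{R}^d$ with an injective homomorphism $\rho:L\to\mathbb{R}^d$ (period homomorphism) such that $\Gamma:=\rho(L)$ is a lattice group (the integer span of a basis of $\mathbb{R}^d$) and $\Phi(\sigma x)=\Phi(x)+\rho(\sigma)$ for all $x\in V,\sigma\in L$. It is nondegenerate if $\Phi$ is injective on $V$. First passage percolation. Edges $e$ carry i.i.d. passage times $t_e$ with law $\nu$; $T(\gamma)=\sum_{e\in\gamma}t_e$ for a path $\gamma$. For $x,y\in\mathbb{R}^d$, $T(x,y)$ is the infimum of $T(\gamma)$ over paths from $x'$ to $y'$, where $x',y'\in V$ are the vertices whose images under $\Phi$ are closest to $x,y$ (ties broken by a fixed $\Gamma$-translation-invariant rule). Let $\mathcal{D}$ be the set of rational linear combinations of a basis of $\Gamma$.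 For $x\in\mathcal{D}$, $\mu(x)$ is the almost sure, deterministic limit $\lim_{n\to\infty}T(0,nx)/n$ (here $0\in\mathbb{R}^d$); $\mu$ is extended continuously to $\mathbb{R}^d$. The limit shape is $\mathcal{B}_\Phi=\{x\in\mathbb{R}^d:\mu(x)\le1\}$ (all of $\mathbb{R}^d$ when $\nu(\{0\})\ge p_c(X)$, the critical probability of independent bond percolation on $X$). *)

(* Defs.v *)
From HB Require Import structures.
From mathcomp Require Import all_boot all_order all_algebra.
From mathcomp Require Import all_classical all_reals all_analysis.
Import Order.TTheory GRing.Theory Num.Theory.
Import numFieldNormedType.Exports.

Set Implicit Arguments.
Unset Strict Implicit.
Unset Printing Implicit Defensive.

Local Open Scope classical_set_scope.
Local Open Scope ring_scope.

Record graph := Graph {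
  vert : Type;
  edge : Type;
  org : edge -> vert;
  tgt : edge -> vert;
  ebar : edge -> edge;
  ebarK : involutive ebar;
  ebar_neq : forall e, ebar e <> e;
  org_ebar : forall e, org (ebar e) = tgt e;
  tgt_ebar : forall e, tgt (ebar e) = org e
}.

Section Walks.
Variable X : graph.

Fixpoint walk (u : vert X) (s : seq (edge X)) (v : vert X) : Prop :=
  if s is e :: s' then org e = u /\ walk (tgt e) s' v else u = v.

Fixpoint walk_in (F : set (edge X)) (s : seq (edge X)) : Prop :=
  if s is e :: s' then F e /\ walk_in F s' else True.

Definition connected_within (F : set (edge X)) : Prop :=
  forall u v, exists s, walk u s v /\ walk_in F s.

Definition connected_graph : Prop := connected_within setT.

(* [s] lists [n] pairwise distinct undirected edges, an undirected edge being
   a pair {e, ebar e} given by one of its two orientations. *)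
Definition distinct_edges n (s : 'I_n -> edge X) : Prop :=
  forall i j, i != j -> s i <> s j /\ s i <> ebar (s j).

Definition disconnecting n (s : 'I_n -> edge X) : Prop :=
  ~ connected_within [set e | forall i, e <> s i /\ e <> ebar (s i)].

Definition is_edge_connectivity (l : nat) : Prop :=
  (exists s : 'I_l -> edge X, distinct_edges s /\ disconnecting s) /\
  (forall n (s : 'I_n -> edge X),
     distinct_edges s -> disconnecting s -> (l <= n)%N).

End Walks.

Definition free_abelian_of_rank (L : zmodType) (d : nat) : Prop :=
  exists b : 'I_d -> L,
    bijective (fun z : {ffun 'I_d -> int} => \sum_(i < d) b i *~ z i).

Record crystal_lattice (d : nat) := CrystalLattice {
  cgraph :> graph;
  clattice : zmodType;
  vact : clattice -> vert cgraph -> vert cgraph;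
  eact : clattice -> edge cgraph -> edge cgraph;
  vact0 : forall x, vact 0 x = x;
  vactD : forall a b x, vact (a + b) x = vact a (vact b x);
  eact0 : forall e, eact 0 e = e;
  eactD : forall a b e, eact (a + b) e = eact a (eact b e);
  org_eact : forall a e, org (eact a e) = vact a (org e);
  tgt_eact : forall a e, tgt (eact a e) = vact a (tgt e);
  ebar_eact : forall a e, ebar (eact a e) = eact a (ebar e);
  vact_free : forall a x, vact a x = x -> a = 0;
  eact_free : forall a e, eact a e <> ebar e;
  connectedX : connected_graph cgraph;
  clattice_free : free_abelian_of_rank clattice d;
  (* the quotient graph is finite: finitely many vertex and edge orbits *)
  finite_vquot : finite_set (range (fun x => range (vact^~ x)));
  finite_equot : finite_set (range (fun e => range (eact^~ e)))
}.

Section Realizations.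
Variables (R : realType) (d : nat).

(* The columns of the invertible matrix [B] are a basis of R^d whose integer
   span is [G]. *)
Definition lattice_basis (B : 'M[R]_d) (G : set 'cV[R]_d) : Prop :=
  B \in unitmx /\ G = range (fun z : 'cV[int]_d => B *m map_mx intr z).

Definition rational_span (G : set 'cV[R]_d) : set 'cV[R]_d :=
  [set x | exists2 B, lattice_basis B G &
             exists q : 'cV[rat]_d, x = B *m map_mx ratr q].

(* Closeness of vertices is Euclidean; the library norm on matrices is the sup
   norm. *)
Definition euclidean_norm (x : 'cV[R]_d) : R :=
  Num.sqrt (\sum_(i < d) x i 0 ^+ 2).

Record realization (X : crystal_lattice d) := Realization {
  pos :> vert X -> 'cV[R]_d;
  period : clattice X -> 'cV[R]_d;
  periodD : {morph period : a b / a + b};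
  period_inj : injective period;
  period_lattice : exists B, lattice_basis B (range period);
  pos_vact : forall a x, pos (vact a x) = pos x + period a
}.

Variable X : crystal_lattice d.

Definition nondegenerate_realization (F : realization X) : Prop := injective (pos F).

Lemma translate_vact (F : realization X) (b : 'cV[R]_d) a x :
  pos F (vact a x) + b = pos F x + b + period F a.
Proof. by rewrite pos_vact addrAC. Qed.

Definition translate (F : realization X) (b : 'cV[R]_d) : realization X :=
  @Realization X (fun x => pos F x + b) (period F)
    (@periodD X F) (@period_inj X F) (period_lattice F) (translate_vact F b).

Section Transform.
Variables (A : 'M[R]_d) (hA : A \in unitmx) (F : realization X).

Lemma transformD : {morph (fun a => A *m period F a) : a b / a + b}.
Proof. by move=> a b; rewrite periodD mulmxDr. Qed.

Lemma transform_inj : injective (fun a => A *m period F a).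
Proof. by move=> a b /(can_inj (mulKmx hA)) /period_inj. Qed.

Lemma transform_lattice :
  exists B, lattice_basis B (range (fun a => A *m period F a)).
Proof.
have [B [uB eB]] := period_lattice F.
exists (A *m B); split; first by rewrite unitmx_mul hA uB.
apply/seteqP; split => [_ [a _ <-]|_ [z _ <-]].
  have : range (period F) (period F a) by exists a.
  by rewrite eB => -[z _ <-]; exists z => //; rewrite mulmxA.
have : range (period F) (B *m map_mx intr z) by rewrite eB; exists z.
by move=> [a _ e]; exists a => //; rewrite e mulmxA.
Qed.

Lemma transform_vact a x :
  A *m pos F (vact a x) = A *m pos F x + A *m period F a.
Proof. by rewrite pos_vact mulmxDr. Qed.

Definition transform : realization X :=
  Realization transformD transform_inj transform_lattice transform_vact.

End Transform.

(* A choice of a nearest vertex for every point of R^d, compatible with the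
   translations by the lattice group. *)
Record nearest_rule (F : realization X) := NearestRule {
  nearest :> 'cV[R]_d -> vert X;
  nearest_min : forall x v,
    euclidean_norm (pos F (nearest x) - x) <= euclidean_norm (pos F v - x);
  nearest_period : forall x a, nearest (x + period F a) = vact a (nearest x)
}.

End Realizations.

Section FirstPassage.
Variables (R : realType) (d0 : measure_display) (W : measurableType d0).
Variable P : probability W R.

(* Mutual independence of a finite family; subfamilies are covered by taking
   some of the [A i] to be [setT]. *)
Definition iid n (Y : 'I_n -> {RV P >-> R}) (nu : probability R R) : Prop :=
  (forall i (A : set R), measurable A -> P (Y i @^-1` A) = nu A) /\
  (forall A : 'I_n -> set R, (forall i, measurable (A i)) ->
     P (\bigcap_(i in [set: 'I_n]) (Y i @^-1` A i)) =
     (\prod_(i < n) P (Y i @^-1` A i))%E).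

Definition iid_passage_times (X : graph) (t : edge X -> {RV P >-> R})
    (nu : probability R R) : Prop :=
  (forall e w, t (ebar e) w = t e w) /\
  (forall n (s : 'I_n -> edge X), distinct_edges s ->
     iid (fun i => t (s i)) nu).

Definition passage_time (X : graph) (t : edge X -> {RV P >-> R})
    (u v : vert X) (w : W) : R :=
  inf [set \sum_(e <- s) t e w | s in [set s | walk u s v]].

Variables (d : nat) (X : crystal_lattice d) (t : edge X -> {RV P >-> R}).

Definition is_time_constant (F : realization R X) (N : nearest_rule F)
    (mu : 'cV[R]_d -> R) : Prop :=
  continuous mu /\
  forall x, rational_span (range (period F)) x ->
    {ae P, forall w, (fun n : nat =>
       passage_time t (N 0) (N (n%:R *: x)) w / n%:R) @ \oo --> mu x}.

(* There is at most one time constant, [rational_span _] being dense; the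
   default value is only a placeholder for when there is none. *)
Definition time_constant (F : realization R X) (N : nearest_rule F) :
    'cV[R]_d -> R :=
  xget (cst 0) [set mu | is_time_constant N mu].

(* No separate case is needed when [nu [set 0]] is at least the critical
   probability of bond percolation: the time constant is then identically 0 and
   the limit shape is the whole space. *)
Definition limit_shape (F : realization R X) (N : nearest_rule F) :
    set 'cV[R]_d :=
  [set x | time_constant N x <= 1].

End FirstPassage.

(* Main.v *)
(* A choice of nearest vertices enters only through its equivariance under the
   period lattice.  For two equivariant choices [N], [N'] and a rational [x],
   [n x] runs, along each residue class of [n], through translates of one point
   by periods, so [T (N (n x), N' (n x))] is a passage time between translates
   of two fixed vertices.  By edge connectivity such a passage time is at most a
   constant times the largest of finitely many minima of [l] distinct edge
   times, and the moment condition with Borel-Cantelli makes it [o(n)] almost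
   surely.  Hence [N] and [N'] have the same time constants.  This gives the
   independence of the realization and of translations; for a linear map [A],
   it is applied to the choice [y |-> N' (A y)], which is equivariant for the
   original periods. *)

Require Import Defs.
From mathcomp Require Import all_boot all_order all_algebra lra.
From mathcomp Require Import all_classical all_reals all_analysis.
From mathcomp Require Import measurable_realfun.
Import Order.TTheory GRing.Theory Num.Theory.
Import numFieldNormedType.Exports.

Set Implicit Arguments.
Unset Strict Implicit.
Unset Printing Implicit Defensive.

Local Open Scope classical_set_scope.
Local Open Scope ring_scope.

(** * Walks and edge connectivity *)

Section Graphs.
Variable X : graph.
Implicit Types (u v : vert X) (e : edge X) (s : seq (edge X)).
Implicit Types (B : set (edge X)).

Lemma walk_cat u v x s1 s2 : walk u s1 v -> walk v s2 x -> walk u (s1 ++ s2) x.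
Proof.
elim: s1 u => [|e s1 ih] u /=; first by move=> ->.
by move=> [-> /ih h] /h.
Qed.

Lemma walk_rev u v s : walk u s v -> walk v (rev (map (@ebar X) s)) u.
Proof.
elim: s u => [|e s ih] u /=; first by move=> ->.
move=> [<- /ih h]; rewrite rev_cons -cats1; apply: walk_cat h _ => /=.
by rewrite org_ebar tgt_ebar.
Qed.

Definition extend_tuple j (A : 'I_j -> edge X) e : 'I_j.+1 -> edge X :=
  fun i => oapp A e (unlift ord0 i).

(** Both orientations of each [A i] have to be excluded, since distinctness is meant for undirected
    edges. *)
Lemma distinct_extend j (A : 'I_j -> edge X) e : distinct_edges A ->
  (forall i, e <> A i /\ e <> ebar (A i)) -> distinct_edges (extend_tuple A e).
Proof.
move=> dA eA i k; rewrite /extend_tuple.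
case: (unliftP ord0 i) => [i' ->|->]; case: (unliftP ord0 k) => [k' ->|->] //=.
- by rewrite (inj_eq lift_inj); exact: dA.
- move=> _; have [h1 h2] := eA i'; split=> h; first by apply: h1.
  by apply: h2; rewrite h ebarK.
Qed.

(* Menger-type duality, stated without flows: either a short walk avoids [B], or
   [B] contains one of finitely many [l]-tuples of distinct edges. *)
Definition short_walk_or_tuple l u v (m : nat) (S : set ('I_l -> edge X)) B :=
  (exists s, [/\ walk u s v, (size s <= m)%N & walk_in (~` B) s]) \/
  (exists2 a, S a & forall i, B (a i)).

Lemma short_walk_or_tuple_mono l u v m m' (S S' : set ('I_l -> edge X)) B :
  (m <= m')%N -> S `<=` S' ->
  short_walk_or_tuple u v m S B -> short_walk_or_tuple u v m' S' B.
Proof.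
move=> mm SS [[s [ws sm sB]]|[a Sa aB]]; [left|right].
  by exists s; split=> //; exact: leq_trans mm.
by exists a => //; exact: SS.
Qed.

(** Induction on the number [n] of edges that [A] lacks to have [l]. As long as some are missing, a
    walk from [u] to [v] avoids [A]; either it avoids [B] too, or one of its edges lies in [B] and
    extends [A]. The walk depends on [A] alone, so the length bound and the tuples are fixed before
    [B] is. *)
Lemma edge_connectivity_walk_or_tuple_ext l u v : is_edge_connectivity X l ->
  forall n j (A : 'I_j -> edge X), distinct_edges A -> (j + n)%N = l ->
  exists (m : nat) (S : set ('I_l -> edge X)),
    [/\ finite_set S, forall a, S a -> distinct_edges a
      & forall B, (forall i, B (A i)) -> short_walk_or_tuple u v m S B].
Proof.
move=> [_ lmin]; elim=> [|n ih] j A dA.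
  rewrite addn0 => jl; subst j; exists 0%N, [set A]; split=> [|_ ->//|B AB].
    exact: finite_set1.
  by right; exists A.
rewrite addnS -addSn => jnl.
(* Here [j < l], so by minimality of [l] removing the edges of [A] leaves the graph connected. *)
have [g [wg gA]] : exists s, walk u s v /\
    walk_in [set e | forall i, e <> A i /\ e <> ebar (A i)] s.
  apply: contrapT => nog.
  have : disconnecting A by move=> /(_ u v).
  by move=> /(lmin _ _ dA); rewrite -jnl -ltn_subRL subnn.
suff [m [S [fS dS H]]] : exists (m : nat) (S : set ('I_l -> edge X)),
    [/\ finite_set S, forall a, S a -> distinct_edges a
      & forall B, (forall i, B (A i)) ->
          walk_in (~` B) g \/ short_walk_or_tuple u v m S B].
  exists (maxn (size g) m), S; split=> // B AB.
  have [gB|] := H B AB; first by left; exists g; split=> //; exact: leq_maxl.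
  by apply: short_walk_or_tuple_mono => //; exact: leq_maxr.
(* Each edge [e] of [g] contributes the bound and the tuples that the outer hypothesis gives for [A]
   extended by [e]; they serve the case where [B] contains [e]. *)
elim: g gA {wg} => [|e g IH] /=.
  by move=> _; exists 0%N, set0; split; [exact: finite_set0| |by left].
move=> [eA /IH[m [S [fS dS HS]]]].
have [m' [S' [fS' dS' HS']]] := ih _ _ (distinct_extend dA eA) jnl.
exists (maxn m m'), (S `|` S'); split=> [|a [/dS|/dS']//|B AB].
  by rewrite finite_setU.
have [Be|nBe] := pselect (B e).
  have h' : forall i, B (extend_tuple A e i).
    move=> i; rewrite /extend_tuple.
    by case: unliftP => [k _|_] /=; [exact: AB|].
  by right; apply: short_walk_or_tuple_mono (HS' B h'); [exact: leq_maxr|right].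
have [gB|h] := HS B AB; first by left.
by right; apply: short_walk_or_tuple_mono h; [exact: leq_maxl|left].
Qed.

Lemma edge_connectivity_walk_or_tuple l u v : is_edge_connectivity X l ->
  exists (m : nat) (S : set ('I_l -> edge X)),
    [/\ finite_set S, forall a, S a -> distinct_edges a
      & forall B, short_walk_or_tuple u v m S B].
Proof.
move=> hl.
have A0 : 'I_0 -> edge X by case.
have dA0 : distinct_edges A0 by case.
have [m [S [fS dS H]]] :=
  edge_connectivity_walk_or_tuple_ext u v hl dA0 (add0n l).
by exists m, S; split=> // B; apply: H; case.
Qed.

End Graphs.

(** * The action of the period lattice on walks and edges *)

Section Lattice.
Variables (d : nat) (X : crystal_lattice d).
Implicit Types (a : clattice X) (s : seq (edge X)).

Lemma walk_eact a u v s : walk u s v ->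
  walk (vact a u) (map (@eact _ X a) s) (vact a v).
Proof.
elim: s u => [|e s ih] u /=; first by move=> ->.
by move=> [<- /ih]; rewrite org_eact tgt_eact.
Qed.

Lemma eactK a : cancel (@eact _ X a) (eact (- a)).
Proof. by move=> e; rewrite -eactD addNr eact0. Qed.

Lemma distinct_eact a n (S : 'I_n -> edge X) :
  distinct_edges S -> distinct_edges (fun i => eact a (S i)).
Proof.
move=> dS i j /dS[h1 h2]; rewrite ebar_eact.
by split=> /(can_inj (eactK a)).
Qed.

Lemma countable_clattice : countable [set: clattice X].
Proof.
have [b [g bK Kb]] := clattice_free X.
apply/countable_injP; exists (pickle \o g) => x y _ _ /= /(pcan_inj pickleK).
exact: can_inj Kb _ _.
Qed.

(** There are finitely many orbits of edges, each an image of the countable period lattice.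
    Countability lets null sets of single edges be united. *)
Lemma countable_edge : countable [set: edge X].
Proof.
have -> : [set: edge X] =
    \bigcup_(O in range (fun e : edge X => range (fun a => eact a e)))
      (O : set (edge X)).
  apply/seteqP; split=> // e _.
  exists (range (fun a => eact a e)); first by exists e.
  by exists 0 => //; exact: eact0.
apply: bigcup_countable; first exact: finite_set_countable (finite_equot X).
move=> _ [e _ <-]; apply: sub_countable countable_clattice.
exact: card_image_le.
Qed.

End Lattice.

(** * Passage times and tail estimates *)

Lemma walk_in_sum_le (R : realType) (X : graph) (f : edge X -> R) (c : R)
    (s : seq (edge X)) : walk_in (~` [set e | c < f e]) s ->
  \sum_(e <- s) f e <= (size s)%:R * c.
Proof.
elim: s => [|e s ih] /=; first by rewrite big_nil mul0r.
move=> [/negP]; rewrite -leNgt => fe /ih h.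
by rewrite big_cons -addn1 natrD mulrDl mul1r addrC lerD.
Qed.

Section Passage.
Variables (R : realType) (d0 : measure_display) (W : measurableType d0).
Variables (P : probability W R) (X : graph).
Variables (t : edge X -> {RV P >-> R}) (w : W).
Hypothesis t_ge0 : forall e, 0 <= t e w.
Hypothesis t_ebar : forall e, t (ebar e) w = t e w.
Hypothesis connX : connected_graph X.
Implicit Types (u v : vert X) (s : seq (edge X)).

Let walk_exists u v : exists s, walk u s v.
Proof. by have [s [us _]] := connX u v; exists s. Qed.

Let passage_set u v := [set \sum_(e <- s) t e w | s in [set s | walk u s v]].

Let passage_set_lb u v : lbound (passage_set u v) 0.
Proof. by move=> _ [s _ <-]; exact: sumr_ge0. Qed.

Let passage_set_nonempty u v : passage_set u v !=set0.
Proof. by have [s us] := walk_exists u v; exists (\sum_(e <- s) t e w), s. Qed.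

Lemma passage_time_le u v s : walk u s v ->
  passage_time t u v w <= \sum_(e <- s) t e w.
Proof.
move=> us; apply: ge_inf; last by exists s.
by exists 0; exact: passage_set_lb.
Qed.

Lemma passage_time_triangle u v x :
  passage_time t u x w <= passage_time t u v w + passage_time t v x w.
Proof.
rewrite -lerBlDr; apply: lb_le_inf (passage_set_nonempty u v) _ => _ [s us <-].
rewrite lerBlDr -lerBlDl; apply: lb_le_inf (passage_set_nonempty v x) _.
move=> _ [s' vs' <-]; rewrite lerBlDl -big_cat.
exact: passage_time_le (walk_cat us vs').
Qed.

Lemma passage_time_sym u v : passage_time t u v w = passage_time t v u w.
Proof.
suff le u' v' : passage_time t u' v' w <= passage_time t v' u' w.
  by apply/eqP; rewrite eq_le !le.
apply: lb_le_inf (passage_set_nonempty v' u') _ => _ [s vs <-].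
rewrite (le_trans (passage_time_le (walk_rev vs)))//.
elim: s {vs} => [|e s ih] //=.
by rewrite rev_cons -cats1 big_cat/= big_seq1 t_ebar big_cons addrC lerD2l.
Qed.

Lemma passage_time_dist u u' v v' :
  `|passage_time t u v w - passage_time t u' v' w|
  <= passage_time t u u' w + passage_time t v v' w.
Proof.
have tr x x' y y' : passage_time t x y w <=
    passage_time t x x' w + passage_time t x' y' w + passage_time t y' y w.
  apply: le_trans (passage_time_triangle x y' y) _.
  by rewrite lerD2r passage_time_triangle.
have := tr u u' v v'; have := tr u' u v' v.
rewrite (passage_time_sym u' u) (passage_time_sym v' v) ler_norml => h1 h2.
by apply/andP; split; lra.
Qed.

End Passage.

(** * Tails of minima of edge times and Borel-Cantelli *)

Section Tail.
Variables (R : realType) (nu : probability R R).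
Hypothesis nu_ge0 : nu [set x : R | 0 <= x] = 1%E.

Lemma probability1_ae d0 (W : measurableType d0) (P : probability W R)
  (A : set W) : measurable A -> P A = 1%E -> {ae P, forall w, A w}.
Proof.
move=> mA PA; exists (~` A); split=> //; first exact: measurableC.
by rewrite probability_setC// PA subee.
Qed.

Definition joint_tail d0 (W : measurableType d0) (P : probability W R) n
  (Y : 'I_n -> {RV P >-> R}) (a : R) : set W := [set w | forall i, a < Y i w].

Section JointTail.
Variables (d0 : measure_display) (W : measurableType d0) (P : probability W R).
Variables (n : nat) (Y : 'I_n -> {RV P >-> R}).

Lemma joint_tailE a :
  joint_tail Y a = \bigcap_(i in [set: 'I_n]) (Y i @^-1` `]a, +oo[).
Proof.
apply/seteqP; split=> w /= h i; have := h i;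
  by rewrite /= in_itv/= andbT// => /(_ I).
Qed.

Lemma measurable_joint_tail a : measurable (joint_tail Y a).
Proof.
rewrite joint_tailE; apply: fin_bigcap_measurable => //i _.
by rewrite -[X in measurable X]setTI; exact: measurable_funP.
Qed.

(** The value depends on [nu] and [n] only, so tails on different probability spaces can be
    compared. *)
Lemma iid_joint_tail a : iid Y nu ->
  P (joint_tail Y a) = (\prod_(i < n) nu `]a, +oo[%classic)%E.
Proof.
move=> [Ynu indep]; rewrite joint_tailE.
rewrite (indep (fun=> `]a, +oo[%classic)) => [|//].
by apply: eq_bigr => i _; rewrite Ynu.
Qed.

Lemma iid_ae_ge0 : iid Y nu -> {ae P, forall w, forall i, 0 <= Y i w}.
Proof.
move=> [Ynu _]; apply: filter_forall => i.
have m0 : measurable [set x : R | 0 <= x].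
  by rewrite (_ : mkset _ = `[0, +oo[%classic)//; apply/seteqP; split=> x;
    rewrite /= in_itv/= andbT.
apply: (@probability1_ae _ _ _ (Y i @^-1` [set x | 0 <= x])).
  by rewrite -[X in measurable X]setTI; exact: measurable_funP.
by rewrite Ynu.
Qed.

End JointTail.

(** If the last term counts, all [K + 1] terms are at most [c ^+ k]; the term [q = 0] accounts for
    the summand [c ^+ k], and the others sum to at most [(c K) ^ k], hence to at most [M ^+ k],
    because [K] is at most its [k]-th power. *)
Lemma count_below_le (k K : nat) (c M : R) : (0 < k)%N -> 0 < c -> 0 <= M ->
  \sum_(q < K) (c ^+ k * (c * q%:R < M)%R%:R) <= c ^+ k + M ^+ k.
Proof.
move=> k0 c0 M0; elim: K => [|K ih].
  by rewrite big_ord0 addr_ge0// exprn_ge0// ltW.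
have [cKM|] := ltP (c * K%:R) M; last first.
  by move=> h; rewrite big_ord_recr/= ltNge h/= mulr0 addr0.
apply: (@le_trans _ _ (\sum_(q < K.+1) c ^+ k)).
  apply: ler_sum => q _.
  by rewrite ler_piMr ?exprn_ge0 ?(ltW c0)// lern1 leq_b1.
rewrite sumr_const card_ord mulrS lerD2l.
have : (c * K%:R) ^+ k <= M ^+ k.
  by rewrite lerXn2r ?nnegrE ?mulr_ge0 ?(ltW c0)// ltW.
apply: le_trans; rewrite exprMn -[leLHS]mulr_natr.
rewrite ler_wpM2l ?exprn_ge0 ?(ltW c0)//.
rewrite -natrX ler_nat; case: K {ih cKM} => // K.
by rewrite -{1}[K.+1]expn1 leq_pexp2l.
Qed.

Section Moment.
Variables (d1 : measure_display) (W1 : measurableType d1).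
Variables (Q : probability W1 R).
Variables (l k : nat) (s : 'I_l -> {RV Q >-> R}).
Hypothesis hs : iid s nu.
Hypothesis k_gt0 : (0 < k)%N.
Let M w : \bar R := (\big[Order.min/+oo]_(i < l) (s i w)%:E)%E.
Hypothesis moment : (\int[Q]_w (M w ^+ k) < +oo)%E.

Let measurable_M : measurable_fun setT M.
Proof.
rewrite /M; elim: (index_enum _) => [|i r ih].
  by under eq_fun do rewrite big_nil; exact: measurable_cst.
under eq_fun do rewrite big_cons.
by apply: measurable_mine => //; apply/measurable_EFinP.
Qed.

Let measurable_MX : measurable_fun setT (fun w => M w ^+ k)%E.
Proof.
elim: k => [|j ih].
  by under eq_fun do rewrite expe0; exact: measurable_cst.
by under eq_fun do rewrite expeS; exact: emeasurable_funM.
Qed.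

Let M_ge0 : {ae Q, forall w, (0 <= M w)%E}.
Proof.
have := iid_ae_ge0 hs; apply: filterS => w s0.
by apply/bigmin_geP; split=> [|i _]; rewrite ?leey// lee_fin.
Qed.

Let integral_absMX_lty : (\int[Q]_w `|M w ^+ k| < +oo)%E.
Proof.
rewrite (@ae_eq_integral _ _ _ _ _ (fun w => M w ^+ k)%E)//.
  exact: measurableT_comp.
by apply: filterS M_ge0 => w M0 _; rewrite gee0_abs// expe_ge0.
Qed.

Let joint_tail_lt a w : joint_tail s a w -> (a%:E < M w)%E.
Proof.
by move=> h; apply/bigmin_gtP; split=> [|i _]; rewrite ?ltry// lte_fin.
Qed.

Let count_tail_le K (c : R) w : 0 < c -> (0 <= M w)%E ->
  ((\sum_(q < K) c ^+ k * \1_(joint_tail s (c * q%:R)) w)%:E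
   <= (c ^+ k)%:E + `|M w ^+ k|)%E.
Proof.
move=> c0; move: (@joint_tail_lt ^~ w); case: (M w) => [m| |]// lt_M M0.
- rewrite -EFin_expe abse_EFin -EFinD lee_fin ger0_norm ?exprn_ge0//.
  apply: le_trans (count_below_le K k_gt0 c0 M0).
  apply: ler_sum => q _; rewrite ler_wpM2l ?exprn_ge0 ?(ltW c0)// indicE.
  case: (boolP (w \in _)) => //; rewrite inE => /lt_M.
  by rewrite lte_fin => ->.
(* For infinite [M w] the right side is infinite, as [k] is positive. *)
- have -> : (+oo ^+ k = +oo :> \bar R)%E.
    case: k k_gt0 => // j _; elim: j => // j ih.
    by rewrite expeS ih mulyy.
  by rewrite addey// leey.
Qed.

(** Integrating [count_tail_le] bounds every partial sum by the same constant, finite by the moment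
    hypothesis. *)
Lemma joint_tail_summable (c : R) : 0 < c ->
  (\sum_(q <oo) Q (joint_tail s (c * q%:R)) < +oo)%E.
Proof.
move=> c0; have ck0 : 0 < c ^+ k by rewrite exprn_gt0.
pose G q := joint_tail s (c * q%:R).
have mG q : measurable (G q) by exact: measurable_joint_tail.
pose C := ((c ^+ k)%:E + \int[Q]_w `|M w ^+ k|)%E.
have partial K : (\sum_(0 <= q < K) Q (G q) <= (c ^+ k)^-1%:E * C)%E.
  rewrite lee_pdivlMl// big_mkord ge0_sume_distrr//.
  have -> : (\sum_(q < K) (c ^+ k)%:E * Q (G q) =
      \int[Q]_w (\sum_(q < K) c ^+ k * \1_(G q) w)%:E)%E.
    under [RHS]eq_integral do rewrite -sumEFin.
    rewrite ge0_integral_sum//.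
    - apply: eq_bigr => q _; under eq_integral do rewrite EFinM.
      rewrite ge0_integralZl//; last by rewrite lee_fin ltW.
        by rewrite integral_indic// setIT.
      by apply/measurable_EFinP; exact: measurable_indic.
    - move=> q; by apply/measurable_EFinP; apply: measurable_funM.
    - by move=> q w _; rewrite lee_fin mulr_ge0// ltW.
  have -> : C = (\int[Q]_w ((c ^+ k)%:E + `|M w ^+ k|))%E.
    rewrite ge0_integralD//.
    - by rewrite integral_cst//= probability_setT mule1.
    - by move=> w _; rewrite lee_fin ltW.
    - exact: measurableT_comp.
  apply: ae_ge0_le_integral => //.
  - by move=> w _; rewrite lee_fin sumr_ge0// => q _; rewrite mulr_ge0// ltW.
  - apply/measurable_EFinP; apply: measurable_sum => q.
    exact: measurable_funM.
  - by move=> w _; rewrite adde_ge0// lee_fin ltW.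
  - by apply: emeasurable_funD => //; exact: measurableT_comp.
  - by apply: filterS M_ge0 => w M0 _; exact: count_tail_le.
apply: (@le_lt_trans _ _ ((c ^+ k)^-1%:E * C)%E).
  by apply: lime_le; [exact: is_cvg_nneseries|exact: nearW].
by rewrite lte_mul_pinfty ?lee_fin ?invr_ge0 ?ltW//= /C lte_add_pinfty ?ltry.
Qed.

(** The first Borel-Cantelli lemma, with the tails of [Y q] under [P] replaced by those of [s] under
    [Q]. Tuples [Y q] for different [q] may be dependent, as happens when translated edges
    overlap. *)
Lemma joint_tail_eventually_not d0 (W : measurableType d0) (P : probability W R)
    (Y : nat -> 'I_l -> {RV P >-> R}) (c : R) : 0 < c ->
  (forall q, iid (Y q) nu) ->
  {ae P, forall w, \forall q \near \oo, ~ joint_tail (Y q) (c * q%:R) w}.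
Proof.
move=> c0 hY; pose F q := joint_tail (Y q) (c * q%:R).
have mF q : measurable (F q) by exact: measurable_joint_tail.
have : P (lim_sup_set F) = 0%E.
  apply: lim_sup_set_cvg0 => //.
  have PF q : P (F q) = Q (joint_tail s (c * q%:R)).
    by rewrite (iid_joint_tail _ hs) -(iid_joint_tail _ (hY q)).
  by rewrite (eq_eseriesr (fun q _ => PF q)); exact: joint_tail_summable.
move=> PF0; exists (lim_sup_set F); split=> //.
  apply: bigcap_measurable => // j _.
  by apply: bigcup_measurable => i _; exact: mF.
move=> w /= nw j _; apply: contrapT => nj; apply: nw.
exists j => // q jq Fq; apply: nj; exists q => //.
Qed.

End Moment.
End Tail.

(** * Sublinear distance between equivariant choices of vertices *)

(** Serves twice for the finite set of tuples: with the almost-everywhere filter and with [\oo]. *)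
Lemma near_finite_forall (I T : Type) (F : set_system T) (FF : Filter F)
    (D : set I) (Q : I -> T -> Prop) : finite_set D ->
  (forall i, D i -> \forall x \near F, Q i x) ->
  \forall x \near F, forall i, D i -> Q i x.
Proof.
move=> /finite_set_leP[n /pcard_leP/unsquash f] H.
have : \forall x \near F, forall k : 'I_n, forall i, D i -> f i = k -> Q i x.
  apply: filter_forall => k.
  have [[i [Di fi]]|nfk] := pselect (exists i, D i /\ f i = k).
    apply: filterS (H i Di) => x Qix j Dj fj.
    have f_inj : {in D &, injective f} by exact: inj.
    by rewrite (f_inj j i) ?inE// fi fj.
  by apply: nearW => x i Di fi; case: nfk; exists i.
apply: filterS => x h i Di; have fin : (f i < n)%N := @funS _ _ _ _ f i Di.
exact: (h (Ordinal fin)).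
Qed.

Lemma natmul_rat_int (y : rat) (k : nat) : (`|denq y| %| k)%N ->
  k%:R * y = (numq y * (k %/ `|denq y|)%N%:Z)%:~R.
Proof.
move=> dk; rewrite -{1}(divnK dk) natrM rmorphM/= numqE [RHS]mulrC -mulrA.
have <- : (`|denq y|%N%:R : rat) = (denq y)%:~R.
  by rewrite -[in RHS](gez0_abs (ltW (denq_gt0 y))).
by rewrite [y * _]mulrC.
Qed.

Section Sublinear.
Variables (R : realType) (nu : probability R R).
Hypothesis nu_ge0 : nu [set x : R | 0 <= x] = 1%E.
Variables (d0 : measure_display) (W : measurableType d0) (P : probability W R).
Variables (d : nat) (X : crystal_lattice d) (t : edge X -> {RV P >-> R}).
Hypothesis ht : iid_passage_times t nu.

Lemma passage_times_ae_ge0 : {ae P, forall w, forall e, 0 <= t e w}.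
Proof.
have /countable_injP[f f_inj] := countable_edge X.
have : {ae P, forall w, forall n e, f e = n -> 0 <= t e w}.
  apply: ae_foralln => n.
  have [[e fe]|nfn] := pselect (exists e, f e = n); last first.
    by apply: nearW => w e fe; case: nfn; exists e.
  have de : distinct_edges (fun _ : 'I_1 => e) by move=> i j; rewrite !ord1.
  have := iid_ae_ge0 nu_ge0 (ht.2 _ _ de).
  apply: filterS => w /(_ ord0) te e' fe'.
  by rewrite (f_inj e' e) ?in_setT// fe fe'.
by apply: filterS => w h e; exact: h.
Qed.

Variables (l : nat) (hl : is_edge_connectivity X l).
Variables (d1 : measure_display) (W1 : measurableType d1).
Variables (Q : probability W1 R).
Variables (s : 'I_l -> {RV Q >-> R}) (hs : iid s nu).
Hypothesis moment : (\int[Q]_w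
      ((\big[Order.min/+oo]_(i < l) (s i w)%:E) ^+ d) < +oo)%E.

(** The edges that are slow at stage [q] are pulled back by [a q] to a set [B] near the fixed [u]
    and [v], so one [m] and one finite [S] serve all [q]. Borel-Cantelli eventually excludes the
    tuples of [S], which leaves a walk of at most [m] edges that are not slow. *)
Lemma passage_time_translates_sublinear (u v : vert X) (a : nat -> clattice X)
    (eps : R) : (0 < d)%N -> 0 < eps ->
  {ae P, forall w, \forall q \near \oo,
     passage_time t (vact (a q) u) (vact (a q) v) w <= eps * q%:R}.
Proof.
move=> d_gt0 eps0.
have [m [S [fS dS mS]]] := edge_connectivity_walk_or_tuple u v hl.
(* A walk of at most [m] edges, each of time at most [c q], then costs at most [eps q]; the
   successor covers [m = 0]. *)
pose c := eps / m.+1%:R; have c0 : 0 < c by rewrite divr_gt0.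
have tuples : {ae P, forall w, forall A, S A -> \forall q \near \oo,
    ~ joint_tail (fun i => t (eact (a q) (A i))) (c * q%:R) w}.
  apply: near_finite_forall => // A SA.
  apply: (joint_tail_eventually_not nu_ge0 hs d_gt0 moment) => // q.
  exact: ht.2 _ _ (distinct_eact (a q) (dS _ SA)).
have := passage_times_ae_ge0; apply: filterS2 tuples => w tuples t0.
have : \forall q \near \oo, forall A, S A ->
    ~ joint_tail (fun i => t (eact (a q) (A i))) (c * q%:R) w.
  exact: near_finite_forall.
apply: filterS => q noS.
have [[g [ug gm]]|[A SA] AB] :=
  mS [set e | c * q%:R < t (eact (a q) e) w]; last by case: (noS A SA).
move=> /walk_in_sum_le gB.
apply: le_trans (passage_time_le t0 (walk_eact (a q) ug)) _.
rewrite big_map (le_trans gB)// mulrA ler_wpM2r// /c mulrCA ger_pMr//.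
by rewrite ler_pdivrMr// mul1r ler_nat ltnW.
Qed.

Section Equivariant.
Variables (F : realization R X) (N N' : 'cV[R]_d -> vert X).
Hypothesis Nper : forall x a, N (x + period F a) = vact a (N x).
Hypothesis N'per : forall x a, N' (x + period F a) = vact a (N' x).

Lemma rational_span_period_multiple x : rational_span (range (period F)) x ->
  exists2 k, (0 < k)%N & exists a, k%:R *: x = period F a.
Proof.
move=> [B [_ GB] [q ->]].
(* A common denominator of the coordinates. *)
pose k := (\prod_(i < d) `|denq (q i ord0)|)%N.
have k0 : (0 < k)%N by apply: prodn_gt0 => i; rewrite absz_gt0 denq_neq0.
pose z : 'cV[int]_d :=
  \col_i (numq (q i ord0) * (k %/ `|denq (q i ord0)|)%N%:Z).
exists k => //; have : range (period F) (B *m map_mx intr z).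
  by rewrite GB; exists z.
move=> [a _ aE]; exists a; rewrite aE scalemxAr; congr (_ *m _).
apply/colP => i; rewrite !mxE.
have dk : (`|denq (q i ord0)| %| k)%N by rewrite /k (bigD1 i)//= dvdn_mulr.
rewrite -(ratr_nat R k) -rmorphM/= -(ratr_int R); congr ratr.
exact: natmul_rat_int.
Qed.

Lemma nearest_passage_sublinear x (eps : R) :
  rational_span (range (period F)) x -> 0 < eps ->
  {ae P, forall w, \forall n \near \oo,
     passage_time t (N (n%:R *: x)) (N' (n%:R *: x)) w <= eps * n%:R}.
Proof.
(* In dimension [0] all points coincide and the passage time is constant in [n]; the tail estimate
   is available for positive exponents only. *)
move=> qx eps0; have [d_eq0|d_gt0] := posnP d.
  have x0 (y : 'cV[R]_d) : y = 0.
    by apply/colP => -[i i_d]; have := i_d; rewrite {1}d_eq0.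
  apply: nearW => w; near=> n; rewrite (x0 (_ *: _)) -ler_pdivrMl//.
  by near: n; exact: nbhs_infty_ger.
have [k k0 [a kxa]] := rational_span_period_multiple qx.
have periodMn q : period F (a *+ q) = q%:R *: period F a.
  elim: q => [|q ih]; last by rewrite mulrSr periodD ih -natr1 scalerDl scale1r.
  by rewrite scale0r; apply: (addrI (period F 0)); rewrite addr0 -periodD addr0.
(* Only the [k] remainders matter up to periods, so finitely many pairs of vertices are
   translated. *)
have split_mul n : n%:R *: x = (n %% k)%:R *: x + period F (a *+ (n %/ k)).
  rewrite periodMn -kxa scalerA -scalerDl -natrM -natrD addnC.
  by rewrite -divn_eq.
have residues : {ae P, forall w, forall r : 'I_k, \forall q \near \oo,
   passage_time t (vact (a *+ q) (N (r%:R *: x)))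
                  (vact (a *+ q) (N' (r%:R *: x))) w <= eps * q%:R}.
  by apply: filter_forall => r; exact: passage_time_translates_sublinear.
apply: filterS residues => w /filter_forall[q0 _ hq0].
(* Beyond this threshold the quotient [n %/ k] is at least [q0]. *)
exists (q0 * k)%N => // n /= q0n.
rewrite split_mul Nper N'per.
have /hq0 : (q0 <= n %/ k)%N by rewrite leq_divRL.
move=> /(_ (Ordinal (ltn_pmod n k0))) /le_trans; apply.
by rewrite ler_wpM2l ?(ltW eps0)// ler_nat leq_div.
Unshelve. all: by end_near. Qed.

(** By [passage_time_dist] the two passage times differ by at most the distances between the
    starting vertices and between the end vertices; the first is constant in [n], the second
    sublinear. *)
Lemma time_constant_transfer x (c : R) : rational_span (range (period F)) x ->
  {ae P, forall w, (fun n : nat =>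
       passage_time t (N 0) (N (n%:R *: x)) w / n%:R) @ \oo --> c} ->
  {ae P, forall w, (fun n : nat =>
       passage_time t (N' 0) (N' (n%:R *: x)) w / n%:R) @ \oo --> c}.
Proof.
move=> qx.
(* The tolerances [1 / (j + 1)] are countably many, so one null set serves them all. *)
have small : {ae P, forall w, forall j, \forall n \near \oo,
    passage_time t (N' (n%:R *: x)) (N (n%:R *: x)) w <= j.+1%:R^-1 * n%:R}.
  apply: ae_foralln => j.
  apply: filterS2 (passage_times_ae_ge0)
    (nearest_passage_sublinear qx (_ : 0 < j.+1%:R^-1)) => [w t0|]; last by [].
  apply: filterS => n.
  by rewrite (passage_time_sym t0 (ht.1^~ w) (@connectedX _ X)).
have := passage_times_ae_ge0; apply: filterS3 small => w small t0.
apply: cvg_sub0; apply/cvgr0Pnorm_le => eps eps0.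
have [j jeps] : exists j, j.+1%:R^-1 <= eps / 2.
  have [j _ /(_ j (leqnn j))] :=
    near_infty_natSinv_lt (PosNum (divr_gt0 eps0 (ltr0Sn R 1))).
  by move=> /ltW; exists j.
near=> n.
have n0 : 0 < n%:R :> R by rewrite ltr0n; near: n; exact: nbhs_infty_gt.
rewrite /= -mulrBl normrM normfV (gtr0_norm n0) ler_pdivrMr//.
have := passage_time_dist t0 (ht.1^~ w) (@connectedX _ X).
move=> /(_ _ _ _ _)/le_trans; apply.
have h1 : passage_time t (N' (n%:R *: x)) (N (n%:R *: x)) w <= eps / 2 * n%:R.
  apply: (@le_trans _ _ (j.+1%:R^-1 * n%:R)); first by near: n; exact: small.
  by rewrite ler_pM2r.
have h2 : passage_time t (N' 0) (N 0) w <= eps / 2 * n%:R.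
  rewrite -ler_pdivrMl ?divr_gt0//; near: n; exact: nbhs_infty_ger.
by rewrite [eps in leRHS]splitr mulrDl lerD.
Unshelve. all: by end_near. Qed.

End Equivariant.

Lemma is_time_constant_period (F F' : realization R X)
    (N : nearest_rule F) (N' : nearest_rule F') mu : period F =1 period F' ->
  is_time_constant t N mu -> is_time_constant t N' mu.
Proof.
move=> pFF' [mu_cont muE]; split=> // x; rewrite -(funext pFF') => qx.
apply: (@time_constant_transfer F N N') (muE x qx) => //.
- exact: nearest_period.
- by move=> y a; rewrite pFF' nearest_period.
Qed.

End Sublinear.

(** * Time constants under linear maps *)

Lemma continuous_mulmxl (R : realType) (m n : nat) (A : 'M[R]_(m, n)) :
  continuous (fun x : 'cV[R]_n => A *m x).
Proof.
move=> x; apply/(@cvg_ballP _ _ _ _ (nbhs_filter x)) => e e0.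
have entries :
    \forall y \near x, forall i, ball ((A *m x) i 0) e ((A *m y) i 0).
  apply: (@filter_forall _ _ _ (nbhs x) (nbhs_filter x)) => i.
  apply: (@cvg_ball R R _ (nbhs x) (nbhs_filter x)
    (fun y => (A *m y) i 0)) => //.
  rewrite mxE; under eq_fun do rewrite mxE.
  elim: (index_enum _) => [|k r ih].
    by rewrite big_nil; under eq_fun do rewrite big_nil; exact: cvg_cst.
  rewrite big_cons; under [X in X @ _]eq_fun do rewrite big_cons.
  by apply: cvgD => //; apply: cvgMr; exact: coord_continuous.
apply: filterS entries => y h; split=> // i j.
by rewrite !ord1; exact: h.
Qed.

(** In the coordinates of the basis [B] this is the density of rational vectors, found entry by
    entry in a sup-norm ball. *)
Lemma dense_rational_span (R : realType) (d : nat) (G : set 'cV[R]_d) B :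
  lattice_basis B G -> dense (rational_span G).
Proof.
move=> BG O [x Ox] oO; have uB := BG.1.
have : \forall v \near invmx B *m x, O (B *m v).
  apply: (continuous_mulmxl (A := B)); rewrite mulKVmx//.
  exact: open_nbhs_nbhs.
move=> /nbhs_ballP[e /= e0 eO].
have rat_near i : exists q : rat, ball ((invmx B *m x) i 0) e (ratr q).
  set y := _ i 0; have [q] := @rat_in_itvoo R (y - e) (y + e) (ltac:(lra)).
  rewrite in_itv/= => yq; exists q; rewrite /ball/= ltr_distlC.
  exact: yq.
have [q qe] := choice rat_near.
pose v : 'cV[rat]_d := \col_i q i.
exists (B *m map_mx ratr v); split; last by exists B => //; exists v.
apply: eO; split=> // i j.
by rewrite !ord1 [X in ball _ _ X]mxE [X in ratr X]mxE; exact: qe.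
Qed.

(** * Uniqueness and transport of time constants *)

Section TimeConstant.
Variables (R : realType) (d0 : measure_display) (W : measurableType d0).
Variables (P : probability W R) (d : nat) (X : crystal_lattice d).
Variable (t : edge X -> {RV P >-> R}).

(** At a rational point both limits hold at a common sample point, since an almost sure event is
    nonempty. Elsewhere, two distinct values would stay distinct on a neighbourhood, which contains
    a rational point. *)
Lemma is_time_constant_unique (F : realization R X) (N : nearest_rule F)
    mu mu' :
  is_time_constant t N mu -> is_time_constant t N mu' -> mu = mu'.
Proof.
move=> [mu_cont muE] [mu'_cont mu'E]; apply/funext => x.
have agree y : rational_span (range (period F)) y -> mu y = mu' y.
  move=> qy; have P_proper : ProperFilter (almost_everywhere P).
    apply: ae_properfilter_algebraOfSetsType.
    by suff : (0 < P setT)%E by []; rewrite probability_setT.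
  have [w [h h']] := @filter_ex _ _ P_proper _
    (@filterI _ _ (@filter_filter _ _ P_proper) _ _ (muE y qy) (mu'E y qy)).
  exact: cvg_unique h h'.
have [B BG] := period_lattice F.
apply: contrapT => /eqP; rewrite -subr_eq0 => neq.
have near_neq : \forall y \near x, mu y - mu' y != 0.
  have c : {for x, continuous (fun y => mu y - mu' y)}.
    by apply: continuousB; [exact: mu_cont|exact: mu'_cont].
  exact: (@cvgr_neq0 _ _ _ (nbhs x) (nbhs_filter x) _ _ c neq).
have [y [near_y /agree muy]] :
    ([set y | mu y - mu' y != 0]° `&` rational_span (range (period F))) !=set0.
  apply: (dense_rational_span BG); last exact: open_interior.
  by exists x.
by have /eqP := interior_subset near_y; rewrite muy subrr.
Qed.

Lemma limit_shape_transport (F F' : realization R X)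
    (N : nearest_rule F) (N' : nearest_rule F') (A : 'M[R]_d) : A \in unitmx ->
  (forall mu, is_time_constant t N' mu <->
              is_time_constant t N (mu \o mulmx A)) ->
  limit_shape t N' = [set A *m x | x in limit_shape t N].
Proof.
move=> uA tcA.
have tcE x : time_constant t N' (A *m x) = time_constant t N x.
  have [[mu tcN]|no_tc] := pselect (exists mu, is_time_constant t N mu).
    have tcN' : is_time_constant t N' (mu \o mulmx (invmx A)).
      apply/tcA; suff -> : (mu \o mulmx (invmx A)) \o mulmx A = mu by [].
      by apply/funext => y /=; rewrite mulKmx.
    have /tcA tc' : is_time_constant t N' (time_constant t N').
      apply: (@xgetPex _ (cst 0) [set mu | is_time_constant t N' mu]).
      by eexists; exact: tcN'.
    have tc : is_time_constant t N (time_constant t N).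
      apply: (@xgetPex _ (cst 0) [set mu | is_time_constant t N mu]).
      by exists mu.
    by rewrite -(is_time_constant_unique tc' tc).
  (* Without a time constant on one side there is none on the other, and both take the default value
     [0]. *)
  rewrite /time_constant !xgetPN// => mu.
    by move=> h; apply: no_tc; exists mu.
  by move=> /tcA h; apply: no_tc; eexists; exact: h.
apply/seteqP; split=> [y /= y1|_ [x /= x1 <-]].
  exists (invmx A *m y); last by rewrite mulKVmx.
  by rewrite /limit_shape/= -tcE mulKVmx.
by rewrite /limit_shape/= tcE.
Qed.

End TimeConstant.

Lemma lattice_basis_mul (R : realType) (d : nat) (A B : 'M[R]_d)
    (G : set 'cV[R]_d) : A \in unitmx -> lattice_basis B G ->
  lattice_basis (A *m B) [set A *m x | x in G].
Proof.
move=> uA [uB ->]; split; first by rewrite unitmx_mul uA.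
by rewrite image_comp; congr (_ @` _); apply/funext => z /=; rewrite mulmxA.
Qed.

Lemma rational_span_mul (R : realType) (d : nat) (A : 'M[R]_d)
    (G : set 'cV[R]_d) x : A \in unitmx -> rational_span G x ->
  rational_span [set A *m y | y in G] (A *m x).
Proof.
move=> uA [B BG [q ->]]; exists (A *m B); first exact: lattice_basis_mul.
by exists q; rewrite mulmxA.
Qed.

Theorem proposition3p4 (R : realType) (d : nat) (X : crystal_lattice d)
    (l : nat) (hl : is_edge_connectivity X l)
    (nu : probability R R) (nu_ge0 : nu [set x : R | 0 <= x] = 1%E)
    (* i.i.d. variables with law nu, for the moment condition *)
    (d1 : measure_display) (W1 : measurableType d1) (Q : probability W1 R)
    (s : 'I_l -> {RV Q >-> R}) (hs : iid s nu)
    (moment : (\int[Q]_w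
      ((\big[Order.min/+oo]_(i < l) (s i w)%:E) ^+ d) < +oo)%E)
    (* the first passage percolation model *)
    (d0 : measure_display) (W : measurableType d0) (P : probability W R)
    (t : edge X -> {RV P >-> R}) (ht : iid_passage_times t nu) :
  [/\ forall (F F' : realization R X)
        (N : nearest_rule F) (N' : nearest_rule F'),
        nondegenerate_realization F ->
        nondegenerate_realization F' ->
        period F =1 period F' ->
        limit_shape t N = limit_shape t N',
      forall (F : realization R X) (b : 'cV[R]_d)
        (N : nearest_rule F) (N' : nearest_rule (translate F b)),
        nondegenerate_realization F ->
        limit_shape t N' = limit_shape t N
    & forall (F : realization R X) (A : 'M[R]_d) (hA : A \in unitmx)
        (N : nearest_rule F) (N' : nearest_rule (transform hA F)),
        nondegenerate_realization F ->
        limit_shape t N' = [set A *m x | x in limit_shape t N]].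
Proof.
have tc_period := is_time_constant_period nu_ge0 ht hl hs moment.
have same_period (F F' : realization R X) (N : nearest_rule F)
    (N' : nearest_rule F') :
    period F =1 period F' -> limit_shape t N = limit_shape t N'.
  move=> pFF'; rewrite /limit_shape /time_constant.
  suff -> : is_time_constant t N = is_time_constant t N' by [].
  by apply/funext => mu; apply/propext; split; exact: tc_period.
(* A translated realization has the same period map by definition, so the second claim is an
   instance of [same_period] as well. *)
split=> [F F' N N' _ _|F b N N' _|F A uA N N' _]; first exact: same_period.
  exact: same_period.
have rangeA : range (period (transform uA F)) =
    [set A *m x | x in range (period F)] by rewrite image_comp.
have rangeF : range (period F) =
    [set invmx A *m x | x in range (period (transform uA F))].
  rewrite rangeA !image_comp; congr (_ @` _).
  by apply/funext => a /=; rewrite mulKmx.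
have spanA x : rational_span (range (period F)) x ->
    rational_span (range (period (transform uA F))) (A *m x).
  by rewrite rangeA; exact: rational_span_mul.
have NA_per x a : N' (A *m (x + period F a)) = vact a (N' (A *m x)).
  by rewrite mulmxDr (nearest_period N').
have N'A0 : N' (A *m 0) = N' 0 by rewrite mulmx0.
apply: limit_shape_transport => // mu; split=> -[mu_cont muE]; split.
- move=> x; apply: continuous_comp; last exact: mu_cont.
  exact: continuous_mulmxl.
- move=> x qx; have := muE _ (spanA x qx); rewrite -N'A0.
  (* Since [n (A x) = A (n x)], the statement about [N'] along [A x] is one about the choice
     [N' (A y)] along [x]. *)
  under eq_near => w do under eq_fun => n do rewrite scalemxAr.
  apply: (time_constant_transfer nu_ge0 ht hl hs moment NA_per) => //.
  exact: nearest_period.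
- have -> : mu = (mu \o mulmx A) \o mulmx (invmx A).
    by apply/funext => y /=; rewrite mulKVmx.
  move=> x; apply: continuous_comp; last exact: mu_cont.
  exact: continuous_mulmxl.
(* Every rational point of the transformed lattice is the image under [A] of a rational point of the
   original one. *)
- move=> y qy; pose x := invmx A *m y.
  have yE : y = A *m x by rewrite mulKVmx.
  have qx : rational_span (range (period F)) x.
    by rewrite rangeF; apply: rational_span_mul => //; rewrite unitmx_inv.
  rewrite yE -N'A0.
  under eq_near => w do under eq_fun => n do rewrite scalemxAr.
  apply: (time_constant_transfer nu_ge0 ht hl hs moment _ NA_per qx) (muE x qx).
  exact: nearest_period.
Qed.
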